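(* Let $m>1$ be an integer and $n=2^m$. Then the zero-divisor graph $\Gamma(\mathbb{Z}_n[i])$ is not pancyclic.
   Context: $\mathbb{Z}_n[i]=\mathbb{Z}[i]/\langle n\rangle=\{a+bi : a,b\in\mathbb{Z}_n\}$ with $i^2=-1$ is the ring of Gaussian integers modulo $n$. For a finite commutative ring $R$ with unity, the zero-divisor graph $\Gamma(R)$ has vertex set $Z(R)\setminus\{0\}$, the nonzero zero-divisors of $R$, with distinct vertices $x,y$ adjacent iff $xy=0$. A graph of order $N\ge 3$ is pancyclic if it contains a cycle of length $k$ for every $k$ with $3\le k\le N$. *)

(* Defs.v *)
From HB Require Import structures.
From mathcomp Require Import all_boot all_order all_algebra.
From mathcomp Require Import ring.

Set Implicit Arguments.
Unset Strict Implicit.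
Unset Printing Implicit Defensive.

Import GRing.Theory.
Local Open Scope ring_scope.

Record sgraph := SGraph {
  vertex :> finType;
  adj : rel vertex;
  adj_sym : symmetric adj;
  adj_irrefl : irreflexive adj }.

Definition has_cycle_of_length (G : sgraph) (k : nat) : Prop :=
  exists c : seq G, [/\ (3 <= k)%N, size c = k & ucycle (@adj G) c].

(* The notion concerns graphs of order at least 3; below that the condition is
   vacuous, so [~ pancyclic G] entails that the order of G is at least 3. *)
Definition pancyclic (G : sgraph) : Prop :=
  forall k : nat, (3 <= k <= #|G|)%N -> has_cycle_of_length G k.

Section ZeroDivisorGraph.

Variable R : finComNzRingType.

Definition zero_divisor (x : R) : bool := [exists y : R, (y != 0) && (x * y == 0)].

Definition zd_vertex : finType := {x : R | zero_divisor x && (x != 0)}.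

Definition zd_adj : rel zd_vertex :=
  fun x y => (x != y) && (val x * val y == 0).

Fact zd_adj_sym : symmetric zd_adj.
Proof. by move=> x y; rewrite /zd_adj eq_sym mulrC. Qed.

Fact zd_adj_irrefl : irreflexive zd_adj.
Proof. by move=> x; rewrite /zd_adj eqxx. Qed.

Definition zero_divisor_graph : sgraph := SGraph zd_adj_sym zd_adj_irrefl.

End ZeroDivisorGraph.

(* [GaussMod a b] stands for a + b i in Z_n[i]. ['Z_n] is the ring of integers
   modulo n only for 1 < n, hence [gaussMod n] is Z_n[i] only for 1 < n. A fresh
   record is used since pairs already carry the componentwise ring structure. *)
Record gaussMod (n : nat) := GaussMod { gre : 'Z_n; gim : 'Z_n }.

Section GaussMod.

Variable n : nat.
Local Notation G := (gaussMod n).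

Definition gauss_pair (x : G) : 'Z_n * 'Z_n := (gre x, gim x).
Definition pair_gauss (p : 'Z_n * 'Z_n) : G := GaussMod p.1 p.2.

Fact gauss_pairK : cancel gauss_pair pair_gauss.
Proof. by case. Qed.

HB.instance Definition _ := Finite.copy G (can_type gauss_pairK).

Definition gzero : G := GaussMod 0 0.
Definition gone : G := GaussMod 1 0.
Definition gopp (x : G) : G := GaussMod (- gre x) (- gim x).
Definition gadd (x y : G) : G := GaussMod (gre x + gre y) (gim x + gim y).
Definition gmul (x y : G) : G :=
  GaussMod (gre x * gre y - gim x * gim y) (gre x * gim y + gim x * gre y).

Fact gaddA : associative gadd.
Proof. by move=> x y z; rewrite /gadd /= !addrA. Qed.
Fact gaddC : commutative gadd.
Proof. by move=> x y; rewrite /gadd addrC [gim x + _]addrC. Qed.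
Fact gadd0 : left_id gzero gadd.
Proof. by case=> a b; rewrite /gadd /= !add0r. Qed.
Fact gaddN : left_inverse gzero gopp gadd.
Proof. by move=> x; rewrite /gadd /= !addNr. Qed.

HB.instance Definition _ := GRing.isZmodule.Build G gaddA gaddC gadd0 gaddN.

Fact gmulA : associative gmul.
Proof. by move=> x y z; congr GaussMod => /=; ring. Qed.
Fact gmulC : commutative gmul.
Proof. by move=> x y; congr GaussMod => /=; ring. Qed.
Fact gmul1 : left_id gone gmul.
Proof. by case=> a b; congr GaussMod => /=; ring. Qed.
Fact gmulDl : left_distributive gmul gadd.
Proof. by move=> x y z; congr GaussMod => /=; ring. Qed.
Fact gone_neq0 : gone != gzero.
Proof. by apply/eqP=> -[]. Qed.

HB.instance Definition _ :=
  GRing.Zmodule_isComNzRing.Build G gmulA gmulC gmul1 gmulDl gone_neq0.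

End GaussMod.

(* Main.v *)
Require Import Defs.
From mathcomp Require Import all_boot all_order all_algebra.
From mathcomp Require Import zify.

(** The vertex 1 + i has degree at most one, because (a + bi)(1 + i) = 0 forces
    a = b and 2a = 0, so that a + bi is 0 or (n/2)(1 + i). A Hamiltonian cycle
    would give it two distinct neighbours. *)

Set Implicit Arguments.
Unset Strict Implicit.
Unset Printing Implicit Defensive.

Import GRing.Theory.

(** Rotate the cycle so that it starts at [x]: the second and the last entries are then both
    adjacent to [x]. *)
Lemma cycle_two_neighbours (G : sgraph) (c : seq G) (x : G) :
    2 < size c -> ucycle (@adj G) c -> x \in c ->
  exists y z, [/\ y != z, adj x y & adj x z].
Proof.
move=> + /andP[+ +] /rot_to[i p rot_c].
rewrite -(size_rot i) -(rot_uniq i) -(rot_cycle i) rot_c {rot_c}.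
(* The length bound rules out [p] with fewer than two entries, so [y] and [z] occupy different
   positions, and uniqueness separates them. *)
case: p => [//|y p]; case: (lastP p) => [//|q z] _ {p}.
rewrite /= rcons_path last_rcons => /andP[xy /andP[_ zx]] /and3P[_ + _].
rewrite mem_rcons inE negb_or => /andP[yz _].
by exists y, z; rewrite yz xy adj_sym.
Qed.

Lemma not_pancyclic_deg_le1 (G : sgraph) (x y : G) :
  2 < #|G| -> (forall z, adj x z -> z = y) -> ~ pancyclic G.
Proof.
move=> G_gt2 deg_x /(_ #|G|); rewrite G_gt2 leqnn => /(_ isT)[c [_ size_c cyc_c]].
have [_ uniq_c] := andP cyc_c.
have x_c : x \in c.
  (* A repetition-free sequence with as many entries as [G] has vertices visits every vertex. *)
  have /subset_cardP eq_c : #|c| = #|{: G}| by rewrite (card_uniqP uniq_c).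
  have /eq_c-> : c \subset {: G} by apply/subsetP.
  by [].
have [|z [t [/eqP neq_zt /deg_x eq_zy /deg_x eq_ty]]] := cycle_two_neighbours _ cyc_c x_c.
  by rewrite size_c.
by apply: neq_zt; rewrite eq_zy eq_ty.
Qed.

Local Open Scope ring_scope.

Lemma Zp_natr_eq0 (n k : nat) :
  (1 < n)%N -> ((k%:R : 'Z_n) == 0) = (n %| k)%N.
Proof. by move=> n_gt1; rewrite -val_eqE /= val_Zp_nat. Qed.

Lemma Zp_double_eq0 (k : nat) (a : 'Z_(2 * k)) :
  (0 < k)%N -> a + a = 0 -> a = 0 \/ a = k%:R.
Proof.
move=> k_gt0; have n_gt1 : (1 < 2 * k)%N by lia.
rewrite -[a]natr_Zp -natrD => /eqP; rewrite Zp_natr_eq0 //.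
have := ltn_ord a; rewrite [X in (_ < X)%N]Zp_cast //.
move: (nat_of_ord a) => b lt_b /dvdnP[q eq_b].
(* Here [b] is the representative of [a] below [2 * k], and [b + b] is [q] times [2 * k], whence
   [q < 2]. *)
have [q0|q1] : (q = 0 \/ q = 1)%N by nia.
- by left; have -> : b = 0%N by lia.
- by right; have -> : b = k by lia.
Qed.

(** The argument needs only an even modulus greater than 2; the bound on [k] keeps [h] different
    from 1, hence [V] different from [U]. *)
Lemma zd_graph_gauss_double_not_pancyclic (k : nat) :
  (1 < k)%N -> ~ pancyclic (zero_divisor_graph (gaussMod (2 * k))).
Proof.
move=> k_gt1; set n := (2 * k)%N; have n_gt1 : (1 < n)%N by rewrite /n; lia.
pose h : 'Z_n := k%:R.
have h_neq0 : h != 0 by rewrite Zp_natr_eq0 //; apply/negP => /dvdn_leq; rewrite /n; lia.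
have hh0 : h + h = 0 by apply/eqP; rewrite -natrD Zp_natr_eq0 // addnn -mul2n.
have two_neq0 : (1 + 1 : 'Z_n) != 0.
  by rewrite -(natrD _ 1 1) Zp_natr_eq0 //; apply/negP => /dvdn_leq; rewrite /n; lia.
have h_neq1 : h != 1 by apply: contra_neq two_neq0 => <-.
pose u : gaussMod n := GaussMod 1 1.
pose v : gaussMod n := GaussMod h h.
(* A third vertex, with [two] as annihilator, shows that the graph has order at least 3, so that
   pancyclicity is not vacuous. *)
pose w : gaussMod n := GaussMod h 0.
pose two : gaussMod n := GaussMod (1 + 1) 0.
have uv0 : u * v = 0 by congr GaussMod; rewrite /= !mul1r ?subrr.
have w20 : w * two = 0.
  by congr GaussMod; rewrite /= ?mulr0 ?mul0r ?subr0 ?addr0 // mulrDr mulr1.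
have u_neq0 : u != 0 by apply/eqP => -[].
have v_neq0 : v != 0 by apply/eqP => -[] /eqP; rewrite (negPf h_neq0).
have w_neq0 : w != 0 by apply/eqP => -[] /eqP; rewrite (negPf h_neq0).
have two_g_neq0 : two != 0 by apply: contra_neq two_neq0 => /(congr1 (@gre n)).
have zd_u : zero_divisor u && (u != 0).
  by rewrite u_neq0 andbT; apply/existsP; exists v; rewrite v_neq0 uv0 eqxx.
have zd_v : zero_divisor v && (v != 0).
  by rewrite v_neq0 andbT; apply/existsP; exists u; rewrite u_neq0 mulrC uv0 eqxx.
have zd_w : zero_divisor w && (w != 0).
  by rewrite w_neq0 andbT; apply/existsP; exists two; rewrite two_g_neq0 w20 eqxx.
pose U : zero_divisor_graph (gaussMod n) := exist _ u zd_u.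
pose V : zero_divisor_graph (gaussMod n) := exist _ v zd_v.
pose W : zero_divisor_graph (gaussMod n) := exist _ w zd_w.
apply: (@not_pancyclic_deg_le1 _ U V).
  have uniq_UVW : uniq [:: U; V; W].
    rewrite /= !inE -!val_eqE /= negb_or !andbT.
    apply/andP; split; [apply/andP; split|].
    - by apply/eqP => -[] /esym/eqP; rewrite (negPf h_neq1).
    - by apply/eqP => -[].
    - by apply/eqP => -[] /eqP; rewrite (negPf h_neq0).
  by have := max_card [in [:: U; V; W]]; rewrite (card_uniqP uniq_UVW).
case=> [[a b] zd_ab] /andP[_ /eqP uz0]; apply: val_inj.
(* The real part of the product is [a - b] and the imaginary part is [b + a]. *)
have := congr1 (@gre n) uz0; have {uz0} := congr1 (@gim n) uz0.
rewrite /= !mul1r => ab1 /subr0_eq eq_ab; rewrite -{}eq_ab in zd_ab ab1 *; move: ab1.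
have [_ ab_neq0] := andP zd_ab.
case/Zp_double_eq0 => [|a0|->//]; first by lia.
by move: ab_neq0; rewrite a0 eqxx.
Qed.

Local Close Scope ring_scope.

Theorem theorem2p1 (m n : nat) (hm : 1 < m) (hn : n = 2 ^ m) :
  ~ pancyclic (zero_divisor_graph (gaussMod n)).
Proof.
case: m hm hn => [//|m] m_gt0 ->; rewrite expnS.
(* Reading 1 as [2 ^ 0] reduces the bound on [k = 2 ^ m] to [0 < m]. *)
by apply: zd_graph_gauss_double_not_pancyclic; rewrite -[1]/(2 ^ 0) ltn_exp2l.
Qed.
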